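(* Let $f$ be a partial height function defined on the boundary of a simply-connected region $R$, and let $v$ be a vertex in the interior of $R$, such that there is a lattice path of $m$ vertices in $R$ from the boundary of $R$ to $v$ (i.e. vertices $x_0,x_1,\dots,x_{m-1}=v$ with $x_0$ on the boundary and consecutive vertices adjacent). Then, for all $c>0$, the probability that $H(v)$ (the value of a random height function at $v$ under the uniform distribution $\mu_f$) differs from its expected value by more than $c\sqrt m$ is less than $2e^{-c^2/32}$.
   Context: A region is a finite union of unit squares of the square lattice that can be tiled by dominos, with a fixed checkerboard coloring of the lattice squares. Two vertices of $R$ are adjacent if they are joined by an edge of a lattice square of $R$. A height function on a simply-connected region $R$ is an integer-valued function $h$ on the vertices of the lattice squares of $R$ such that, for adjacent vertices $u,v$: if the edge $uv$ is part of the boundary of $R$ then $|h(u)-h(v)|=1$, and if the directed edge from $u$ to $v$ has a black square on its left then $h(v)$ is either $h(u)+1$ or $h(u)-3$. Height functions correspond to domino tilings of $R$: the dominos are those bisected by the edges $uv$ with $|h(u)-h(v)|=3$; the correspondence is bijective once the height of one boundary vertex is fixed, and then all height functions agree on the boundary. A partial height function is an integer-valued function on a connected set of vertices of $R$ containing all boundary vertices, subject to $f(v)-f(u)\in\{1,-3\}$ whenever $u,v$ are adjacent in its domain and the directed edge from $u$ to $v$ has a black square on its left. Here $f$ is defined exactly on the boundary vertices. $\mu_f$ is the uniform distribution on the (nonempty) set of complete height functions (those defined on all vertices of $R$) that agree with $f$ where $f$ is defined, and $H$ is a random height function distributed according to $\mu_f$. *)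

(* Defs.v *)
From HB Require Import structures.
From mathcomp Require Import all_boot all_order all_algebra.
From mathcomp Require Import finmap.
From mathcomp Require Import all_classical all_reals all_analysis.
From mathcomp Require Import zify lra.

Set Implicit Arguments.
Unset Strict Implicit.
Unset Printing Implicit Defensive.

Import Order.TTheory GRing.Theory Num.Theory.
Import numFieldNormedType.Exports.

Local Open Scope fset_scope.
Local Open Scope classical_set_scope.
Local Open Scope ring_scope.

(* A pair of integers is either a vertex of the square lattice or the unit
   lattice square having that vertex as its lower left corner. *)
Notation lattice := (int * int)%type.

Definition neighbours (s t : lattice) : bool :=
  `|s.1 - t.1| + `|s.2 - t.2| == 1.

Definition checkerboard (black : pred lattice) : Prop :=
  forall s t, neighbours s t -> black t = ~~ black s.

Definition corners (s : lattice) : seq lattice :=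
  [:: s; (s.1 + 1, s.2); (s.1, s.2 + 1); (s.1 + 1, s.2 + 1)].

Definition domino (d : {fset lattice}) : Prop :=
  exists s t, neighbours s t /\ d = [fset s; t].

Definition tileable (R : {fset lattice}) : Prop :=
  exists T : {fset {fset lattice}},
    (forall d, d \in T -> domino d /\ (d `<=` R)%fset) /\
    (forall s, s \in R -> exists! d, d \in T /\ s \in d).

Section PlaneTopology.
Variable K : realType.

Definition path_connected (T : topologicalType) (S : set T) : Prop :=
  forall x y, S x -> S y -> exists g : K -> T,
    [/\ {within `[0, 1], continuous g}, g @` `[0, 1] `<=` S,
        g 0 = x & g 1 = y].

Definition loops_contractible (T : topologicalType) (S : set T) : Prop :=
  forall g : K -> T,
    {within `[0, 1], continuous g} -> g @` `[0, 1] `<=` S -> g 0 = g 1 ->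
  exists G : K * K -> T,
    [/\ {within `[0, 1] `*` `[0, 1], continuous G},
        G @` (`[0, 1] `*` `[0, 1]) `<=` S,
        forall t, 0 <= t <= 1 -> G (t, 0) = g t,
        forall t, 0 <= t <= 1 -> G (t, 1) = g 0 &
        forall t, 0 <= t <= 1 -> G (0, t) = g 0 /\ G (1, t) = g 0].

Definition simply_connected (T : topologicalType) (S : set T) : Prop :=
  path_connected S /\ loops_contractible S.

Definition boundary (T : topologicalType) (S : set T) : set T :=
  closure S `\` S°.

Definition pt (u : lattice) : K * K := (u.1%:~R, u.2%:~R).

Definition segment (u v : lattice) : set (K * K) :=
  [set ((1 - t) * (pt u).1 + t * (pt v).1,
        (1 - t) * (pt u).2 + t * (pt v).2) | t in `[0, 1]].

(* Squares are closed, so two squares that share only a corner are connected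
   to each other. *)
Definition carrier (R : {fset lattice}) : set (K * K) :=
  [set x | exists2 s, s \in R &
    (pt s).1 <= x.1 <= (pt s).1 + 1 /\
    (pt s).2 <= x.2 <= (pt s).2 + 1].

End PlaneTopology.

Arguments segment : clear implicits.
Arguments carrier : clear implicits.

Definition vertices (R : {fset lattice}) : {fset lattice} :=
  [fset u in flatten [seq corners s | s <- R]].

Definition vertex_adj (R : {fset lattice}) : rel (vertices R) :=
  fun u v => neighbours (val u) (val v) &&
    [exists s : R, (val u \in corners (val s)) && (val v \in corners (val s))].

(* The square on the left of the directed edge from u to v, meaningful only when
   u and v are neighbours; the last branch is the downward edge. *)
Definition left_square (u v : lattice) : lattice :=
  if v == (u.1 + 1, u.2) then u
  else if v == (u.1, u.2 + 1) then (u.1 - 1, u.2)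
  else if v == (u.1 - 1, u.2) then (u.1 - 1, u.2 - 1)
  else (u.1, u.2 - 1).

Section HeightFunctions.
Variables (K : realType) (black : pred lattice) (R : {fset lattice}).

Definition boundary_vertex (u : vertices R) : Prop :=
  boundary (carrier K R) (pt K (val u)).

Definition interior_vertex (u : vertices R) : Prop :=
  (carrier K R)° (pt K (val u)).

Definition boundary_edge (u v : vertices R) : Prop :=
  segment K (val u) (val v) `<=` boundary (carrier K R).

Definition height_function (h : {ffun vertices R -> int}) : Prop :=
  forall u v, vertex_adj u v ->
    (boundary_edge u v -> `|h u - h v| = 1) /\
    (black (left_square (val u) (val v)) -> h v = h u + 1 \/ h v = h u - 3).

Definition connected_vertices (D : pred (vertices R)) : Prop :=
  forall u v, D u -> D v ->
    exists p, [/\ path (@vertex_adj R) u p, last u p = v & all D p].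

(* A function on a subset of the vertices is encoded with values in option int,
   None meaning undefined. *)
Definition partial_height_function (f : vertices R -> option int) : Prop :=
  [/\ connected_vertices (fun u => isSome (f u)),
      forall u, boundary_vertex u -> isSome (f u) &
      forall u v a b, vertex_adj u v -> f u = Some a -> f v = Some b ->
        black (left_square (val u) (val v)) -> b - a = 1 \/ b - a = - 3].

Definition completions (f : vertices R -> option int) :
    set {ffun vertices R -> int} :=
  [set h | height_function h /\ forall u a, f u = Some a -> h u = a].

Variable f : vertices R -> option int.

(* The set of completions is finite as soon as f is defined on the boundary
   (finite_completions below), so fset_set does not take its default value. *)
Definition mu (E : pred {ffun vertices R -> int}) : K :=
  #|` [fset h in fset_set (completions f) | E h] |%:R
  / #|` fset_set (completions f) |%:R.

Definition mu_expectation (X : {ffun vertices R -> int} -> K) : K :=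
  (\sum_(h <- fset_set (completions f)) X h)
  / #|` fset_set (completions f) |%:R.

End HeightFunctions.

Lemma verticesP (R : {fset lattice}) (u : lattice) :
  reflect (exists2 s, s \in R & u \in corners s) (u \in vertices R).
Proof.
apply: (iffP idP); rewrite /vertices inE.
  by move=> /flattenP[l /mapP[s sR ->] us]; exists s.
by case=> s sR us; apply/flattenP; exists (corners s) => //; exact: map_f.
Qed.

Lemma neighbours_left (x y : int) : neighbours (x, y) (x - 1, y).
Proof. by rewrite /neighbours /= opprB addrCA !subrr normr0 !addr0 normr1. Qed.

Lemma left_corners (x y a b : int) : a < x < a + 2 -> b <= y <= b + 1 ->
  (x, y) \in corners (a, b) /\ (x - 1, y) \in corners (a, b).
Proof.
move=> /andP[ax1 ax2] /andP[by1 by2].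
have -> : x = a + 1 by lia.
have [->|->] : y = b \/ y = b + 1 by lia.
  by rewrite addrK !inE !eqxx !orbT.
by rewrite addrK !inE !eqxx !orbT.
Qed.

Lemma interior_left (K : realType) (R : {fset lattice}) (u : vertices R) :
  interior_vertex K u ->
  exists2 w : vertices R, vertex_adj u w &
    val w = ((val u).1 - 1, (val u).2).
Proof.
rewrite /interior_vertex /interior /= -nbhs_ballE => -[e /= e0 sub].
pose d : K := Num.min (e / 2) (1 / 2).
have d0 : 0 < d by rewrite /d lt_min; lra.
have [de d1] : d < e /\ d < 1 by rewrite /d; split; rewrite gt_min; lra.
have : carrier K R ((pt K (val u)).1 - d, (pt K (val u)).2).
  apply: sub; split => /=; rewrite /ball /= ?subrr ?normr0 //.
  by rewrite opprB addrC subrK gtr0_norm.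
case: u {sub} => -[x y] /= uR.
case=> -[a b] sR /= [] /andP[a1 a2] /andP[b1 b2].
have ax : a < x < a + 2.
  rewrite -!(ltr_int K) intrD /=; apply/andP; split; lra.
have yb : b <= y <= b + 1.
  rewrite -!(ler_int K) intrD /=; apply/andP; split; lra.
have [uc wc] := left_corners ax yb.
have wR : (x - 1, y) \in vertices R.
  by apply/verticesP; exists (a, b).
exists [` wR] => //=; apply/andP; split => /=.
  exact: neighbours_left.
by apply/existsP; exists [` sR]; rewrite /= wc uc.
Qed.

Lemma finite_completions (K : realType) (black : pred lattice)
    (R : {fset lattice}) (f : vertices R -> option int) :
  checkerboard black -> (forall u, boundary_vertex K u -> isSome (f u)) ->
  finite_set (completions K black f).
Proof.
move=> chk fbd.
have int_or_bd (u : vertices R) : interior_vertex K u \/ boundary_vertex K u.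
  have cu : carrier K R (pt K (val u)).
    have : val u \in vertices R by exact: fsvalP.
    case: (val u) => x y /verticesP[[a b] sR cs].
    exists (a, b) => //; rewrite /pt /=; move: cs.
    rewrite !inE !xpair_eqE /= => /or4P[] /andP[/eqP -> /eqP ->];
      rewrite ?intrD /=; split; lra.
  have [|nu] := pselect (interior_vertex K u); [by left|right].
  by split => //; apply: subset_closure.
have step (u w : vertices R) h : completions K black f h -> vertex_adj u w ->
    val w = ((val u).1 - 1, (val u).2) -> `|h u| <= `|h w| + 3.
  move=> [hh _] uw wE.
  have wu : vertex_adj w u.
    move: uw; rewrite /vertex_adj => /andP[n /existsP[s /andP[s1 s2]]].
    apply/andP; split; last by apply/existsP; exists s; rewrite s1 s2.
    by move: n; rewrite /neighbours; lia.
  have [_ a1] := hh _ _ uw; have [_ a2] := hh _ _ wu.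
  move: a1 a2; rewrite wE; case: (val u) => x y /=.
  rewrite /left_square /= !xpair_eqE.
  have -> : (x - 1 == x + 1 :> int) = false by lia.
  have -> : (x - 1 == x :> int) = false by lia.
  rewrite !eqxx /= subrK !eqxx /=.
  have := chk (x - 1, y - 1) (x - 1, y).
  rewrite /neighbours /= => ->; last by lia.
  by case: (black _) => /= a1 a2; [have := a1 isT|have := a2 isT]; lia.
have bnd : forall (n : nat) (u : vertices R),
    (#|[set w : vertices R | ((val w).1 < (val u).1)%R]%SET| < n)%N ->
    exists B : nat, forall h, completions K black f h -> `|h u| <= B%:Z.
  elim=> // n IH u un.
  have [iu|bu] := int_or_bd u.
    have [w uw wE] := interior_left iu.
    have [|B HB] := IH w.
      rewrite ltnS in un; apply: leq_trans un; apply: proper_card.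
      apply/properP; split.
        by apply/fintype.subsetP => z; rewrite !inE wE /=; lia.
      by exists w; rewrite !inE wE /=; lia.
    exists (B + 3)%N => h ch; have := step _ _ _ ch uw wE.
    by have := HB _ ch; lia.
  have := fbd _ bu; case fu : (f u) => [a|//] _.
  by exists `|a|%N => h [_ /(_ _ _ fu) ->]; lia.
have /choice[B HB] : forall u, exists B : nat,
    forall h, completions K black f h -> `|h u| <= B%:Z.
  by move=> u; apply: (bnd _ u (ltnSn _)).
pose M := \max_u B u.
pose F (g : {ffun vertices R -> 'I_(M + M).+1}) : {ffun vertices R -> int} :=
  [ffun u => (g u)%:Z - M%:Z].
apply: (@sub_finite_set _ _ (F @` setT)); last exact: finite_image.
move=> h ch; exists [ffun u => inord `|(h u + M%:Z)%R|%N] => //.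
apply/ffunP => u; rewrite !ffunE.
have hu := HB u h ch.
have : (B u <= M)%N by apply: leq_bigmax.
move=> BM; rewrite inordK; last by lia.
by rewrite gez0_abs ?addrK //; lia.
Qed.

(* Main.v *)
Require Import Defs.
From mathcomp Require Import all_boot all_order all_algebra.
From mathcomp Require Import finmap.
From mathcomp Require Import all_classical all_reals all_analysis.
From mathcomp Require Import zify lra ring.

(* The completions agree modulo 4 at every vertex, so they form a distributive
   lattice under pointwise minimum and maximum; moreover, for completions g and
   h, so are min(g, h + 4) and max(g - 4, h). All of this survives fixing the
   height at some vertices. Reveal the heights along the path one at a time: the
   next height takes at most two values, b and b + 4. By the four functions
   theorem the conditional mean of H(v) is at least as large given b + 4 as given
   b, and comparing with the translate by 4 shows that it exceeds it by at most
   4. Hoeffding's lemma for two points then bounds the moment generating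
   function of H(v) - E H(v) by exp(8 t^2 (m - 1)), and Markov's inequality at
   t = c / (16 sqrt m) concludes. *)

Set Implicit Arguments.
Unset Strict Implicit.
Unset Printing Implicit Defensive.

Import Order.TTheory GRing.Theory Num.Theory.
Import numFieldNormedType.Exports.

Local Open Scope classical_set_scope.
Local Open Scope ring_scope.

(** * Correlation inequalities *)

Section FourFunctions.
Import boot.finset.
Local Open Scope set_scope.

(** The one-point case of the four functions theorem: index 1 means that the set contains the point.
    A mixed pair has its intersection without the point and its union with it, so [c0 * d1] bounds
    both mixed products. *)
Lemma four_numbers (a0 a1 b0 b1 c0 c1 d0 d1 : nat) :
  (a0 * b0 <= c0 * d0 -> a0 * b1 <= c0 * d1 -> a1 * b0 <= c0 * d1 ->
   a1 * b1 <= c1 * d1 ->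
   (a0 + a1) * (b0 + b1) <= (c0 + c1) * (d0 + d1))%N.
Proof.
move=> h00 h01 h10 h11.
have [cd0|cd0] := posnP (c0 * d1)%N; first by nia.
rewrite -(leq_pmul2r cd0).
(* (r - p) (r - q) >= 0 with p = a0 b1 <= r, q = a1 b0 <= r, r = c0 d1 *)
have k1 : (c0 * d1 * (a0 * b0 + a0 * b1 + a1 * b0 + a1 * b1) <=
    (c0 * d1 + a1 * b1) * (a0 * b0 + c0 * d1))%N by nia.
have k2 : ((c0 * d1 + a1 * b1) * (a0 * b0 + c0 * d1) <=
    (c0 * d1 + c1 * d1) * (c0 * d0 + c0 * d1))%N.
  by apply: leq_mul; lia.
lia.
Qed.

Lemma sum_powersetD1 (T : finType) (S : {set T}) (x : T) (a : {set T} -> nat) :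
  x \in S ->
  (\sum_(X : {set T} | X \subset S) a X =
   \sum_(X : {set T} | X \subset S :\ x) (a X + a (x |: X)))%N.
Proof.
move=> xS; rewrite (bigID (fun X : {set T} => x \in X)) /= addnC big_split /=.
congr (_ + _)%N; first by apply: eq_bigl => X; rewrite subsetD1.
rewrite (reindex_onto (fun X => x |: X) (fun X => X :\ x)) /=.
  apply: eq_bigl => X; rewrite setU11 andbT subUset sub1set xS subsetD1.
  case: (boolP (x \in X)) => xX; rewrite ?andbT ?andbF.
    by apply/negP => /andP[_ /eqP E]; move: xX; rewrite -E !inE eqxx.
  by rewrite setU1K // eqxx andbT.
by move=> X /andP[_ xX]; rewrite setD1K.
Qed.

(* Ahlswede-Daykin, by induction on [S]. *)
Lemma four_functions (T : finType) (S : {set T}) (a b c d : {set T} -> nat) :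
  (forall X Y : {set T}, X \subset S -> Y \subset S ->
     (a X * b Y <= c (X :&: Y) * d (X :|: Y))%N) ->
  ((\sum_(X : {set T} | X \subset S) a X) *
     (\sum_(X : {set T} | X \subset S) b X) <=
   (\sum_(X : {set T} | X \subset S) c X) *
     (\sum_(X : {set T} | X \subset S) d X))%N.
Proof.
move En : #|S| => n; elim: n S a b c d En => [|n IH] S a b c d cardS H.
  have S0 : S = set0 by apply/eqP; rewrite -cards_eq0 cardS.
  rewrite !(big_pred1 set0) => [||||]; try by move=> X; rewrite S0 subset0.
  by have := H set0 set0; rewrite setI0 setU0; apply; rewrite S0.
have [x xS] : exists x, x \in S by apply/set0Pn; rewrite -cards_eq0 cardS.
rewrite !(@sum_powersetD1 _ S x) //.
apply: IH => [|X Y]; first by move: cardS; rewrite (cardsD1 x) xS => -[].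
rewrite !subsetD1 => /andP[XS nX] /andP[YS nY].
have XS1 : x |: X \subset S by rewrite subUset sub1set xS.
have YS1 : x |: Y \subset S by rewrite subUset sub1set xS.
have xI (Z : {set T}) : x \notin Z -> [set x] :&: Z = set0.
  by move=> nZ; apply/setP => z; rewrite !inE; case: eqVneq => // ->; apply: negbTE.
apply: four_numbers.
- exact: H.
- by have := H X (x |: Y) XS YS1; rewrite setUCA setIUr setIC xI ?set0U.
- by have := H (x |: X) Y XS1 YS; rewrite -setUA setIUl xI ?set0U.
- by have := H _ _ XS1 YS1; rewrite -setUIr -setUUr.
Qed.

End FourFunctions.

Definition fmin (V : finType) (h g : {ffun V -> int}) : {ffun V -> int} :=
  [ffun u => Num.min (h u) (g u)].

Definition fmax (V : finType) (h g : {ffun V -> int}) : {ffun V -> int} :=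
  [ffun u => Num.max (h u) (g u)].

Section Holley.
Import boot.finset.
Local Open Scope set_scope.

(* A function is encoded by the set of its subgraph, which turns minimum and
   maximum into intersection and union. *)
Lemma holley (V : finType) (L U : seq {ffun V -> int})
    (w : {ffun V -> int} -> nat) :
  uniq L -> uniq U ->
  (forall h g, h \in L -> g \in U -> fmin h g \in L /\ fmax h g \in U) ->
  (forall h g : {ffun V -> int}, (forall u, h u <= g u) -> (w h <= w g)%N) ->
  (size U * \sum_(h <- L) w h <= size L * \sum_(g <- U) w g)%N.
Proof.
move=> uL uU LU w_mono.
pose M := \max_(h <- L ++ U) \max_u `|h u|%N.
have hM h u : h \in L ++ U -> `|h u| <= M%:Z.
  move=> hLU; suff: (`|h u| <= M)%N by lia.
  apply: leq_trans (leq_bigmax_seq _ hLU _) => //.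
  exact: (@leq_bigmax _ (fun u => `|h u|%N) u).
(* Level [i] stands for the height [i - M]; these levels separate any two heights in [-M, M]. *)
clearbody M; pose enc (h : {ffun V -> int}) : {set V * 'I_(M + M)} :=
  [set z : V * 'I_(M + M) | (z.2 : nat)%:Z - M%:Z < h z.1].
have encI h g : enc (fmin h g) = enc h :&: enc g.
  by apply/setP => z; rewrite !inE ffunE lt_min.
have encU h g : enc (fmax h g) = enc h :|: enc g.
  by apply/setP => z; rewrite !inE ffunE lt_max.
have enc_inj : {in L ++ U &, injective enc}.
  move=> h g hLU gLU /setP E; apply/ffunP => u.
  have le_of (h' g' : {ffun V -> int}) : h' \in L ++ U -> g' \in L ++ U ->
      (forall z, z \in enc h' -> z \in enc g') -> h' u <= g' u.
    move=> /(hM _ u) h'M /(hM _ u) g'M sub.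
    rewrite leNgt; apply/negP => lt.
    have bnd (p q : int) : `|p| <= M%:Z -> `|q| <= M%:Z -> q < p ->
        (`|(q + M%:Z)%R| < M + M)%N /\ 0 <= q + M%:Z by lia.
    (* The level of height [g' u] lies in the subgraph of [h'] but not in that of [g']. *)
    have [lt2 ge0] := bnd _ _ h'M g'M lt.
    have := sub (u, Ordinal lt2); rewrite !inE /= gez0_abs //.
    by rewrite addrK ltxx lt => /(_ isT).
  by apply/eqP; rewrite eq_le !le_of // => z; rewrite E.
pose wt (A : seq {ffun V -> int}) (F : {ffun V -> int} -> nat) X :=
  (\sum_(h <- A | enc h == X) F h)%N.
have wtE A F g : {subset A <= L ++ U} -> uniq A -> g \in A ->
    wt A F (enc g) = F g.
  move=> sA uA gA; rewrite /wt -big_filter (bigD1_seq g) /=; last 2 first.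
  - by rewrite mem_filter eqxx.
  - exact: filter_uniq.
  rewrite big1_seq ?addn0 // => h /andP[hg]; rewrite mem_filter => /andP[/eqP E hA].
  by move: hg; rewrite (enc_inj _ _ (sA _ hA) (sA _ gA) E) eqxx.
have wt0 A F X : X \notin [seq enc h | h <- A] -> wt A F X = 0%N.
  move=> nX; rewrite /wt big1_seq // => h /andP[/eqP E hA].
  by move: nX; rewrite -E map_f.
have sum_wt A F : (\sum_(h <- A) F h =
    \sum_(X : {set V * 'I_(M + M)} | X \subset setT) wt A F X)%N.
  by rewrite (partition_big enc (fun X => X \subset setT)) // => h _; rewrite subsetT.
have sL : {subset L <= L ++ U} by move=> h hL; rewrite mem_cat hL.
have sU : {subset U <= L ++ U} by move=> h hU; rewrite mem_cat hU orbT.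
rewrite -!sum1_size mulnC [X in (_ <= X)%N]mulnC.
rewrite !sum_wt mulnC [X in (_ <= X)%N]mulnC.
(* Here a and c are the indicators of [U] and [L], and b and d are [w] carried by [L] and [U], all
   transported along [enc] and zero off its image. *)
apply: four_functions => X Y _ _.
have [/mapP[g gU ->]|nX] := boolP (X \in [seq enc h | h <- U]); last first.
  by rewrite (wt0 U).
have [/mapP[h hL ->]|nY] := boolP (Y \in [seq enc h | h <- L]); last first.
  by rewrite (wt0 L _ Y) // muln0.
have [mL mU] := LU _ _ hL gU.
rewrite setIC setUC -encI -encU !wtE // !mul1n.
by apply: w_mono => u; rewrite ffunE le_max lexx.
Qed.

End Holley.

(** * Exponential moments *)

Lemma expR_le_inv (K : realType) (y : K) : y < 1 -> expR y <= (1 - y)^-1.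
Proof.
move=> y1; rewrite -[expR y]invrK -expRN lef_pV2 ?posrE ?expR_gt0 //; last lra.
exact: (@expR_ge1Dx K (- y)).
Qed.

(** Squaring exp(x/2) <= 1/(1 - x/2) and adding gives a rational function of y = x^2 that is at most
    2(1 + y) for y <= 1/4. Without halving, the sum 2/(1 - y) would be too large. *)
Lemma cosh_le_small (K : realType) (x : K) : `|x| <= 1 / 2 ->
  expR x + expR (- x) <= 2 * expR (x ^+ 2).
Proof.
rewrite ler_norml => /andP[x1 x2].
have e (z : K) : expR z = expR (z / 2) ^+ 2.
  by rewrite -expRM_natl; congr expR; lra.
have b (z : K) : -1 / 2 <= z -> z <= 1 / 2 -> expR z <= (1 - z / 2)^-1 ^+ 2.
  move=> z1 z2; rewrite e; apply: lerXn2r; rewrite ?nnegrE ?expR_ge0 ?invr_ge0 //.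
    lra.
  by apply: expR_le_inv; lra.
have b1 : expR x <= (1 - x / 2)^-1 ^+ 2 by apply: b; lra.
have b2 : expR (- x) <= (1 - (- x) / 2)^-1 ^+ 2 by apply: b; lra.
apply: (@le_trans _ _ (2 * (1 + x ^+ 2))); last first.
  by rewrite ler_pM2l //; exact: expR_ge1Dx.
apply: (le_trans (lerD b1 b2)).
set y := x ^+ 2.
have y0 : 0 <= y by rewrite /y sqr_ge0.
have y1 : y <= 1 / 4 by rewrite /y; nra.
have -> : (1 - x / 2)^-1 ^+ 2 + (1 - - x / 2)^-1 ^+ 2 =
    (2 + y / 2) / (1 - y / 4) ^+ 2.
  by rewrite /y; field; apply/and3P; split; rewrite ?gt_eqF //; nra.
rewrite ler_pdivrMr; last by apply: exprn_gt0; lra.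
nra.
Qed.

(* Doubling: cosh (2 x) = 2 (cosh x)^2 - 1 <= (cosh x)^4. *)
Lemma cosh_le (K : realType) (x : K) :
  expR x + expR (- x) <= 2 * expR (x ^+ 2).
Proof.
have dbl (y : K) : expR y + expR (- y) <= 2 * expR (y ^+ 2) ->
    expR (2 * y) + expR (- (2 * y)) <= 2 * expR ((2 * y) ^+ 2).
  move=> H.
  have -> : expR ((2 * y) ^+ 2) = expR (y ^+ 2) ^+ 4.
    by rewrite -expRM_natl; congr expR; ring.
  rewrite -mulrN !expRM_natl.
  have ab : expR y * expR (- y) = 1 by rewrite -expRD subrr expR0.
  set a := expR y in H ab *; set b := expR (- y) in H ab *.
  have a0 : 0 < a by exact: expR_gt0.
  have b0 : 0 < b by exact: expR_gt0.
  set c := expR (y ^+ 2) in H *.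
  have c0 : 0 < c by exact: expR_gt0.
  have k : (a + b) ^+ 4 <= (2 * c) ^+ 4 by apply: lerXn2r; rewrite ?nnegrE; nra.
  set s := (a + b) ^+ 2.
  have sE : a ^+ 2 + b ^+ 2 = s - 2 by rewrite /s; lra.
  have : s ^+ 2 <= 16 * c ^+ 4 by rewrite /s -exprM; move: k; rewrite exprMn; lra.
  (* Here s = 4 (cosh y)^2, and the square is the inequality 2 C^2 - 1 <= C^4 for C = cosh y. *)
  rewrite sE => k2; have := sqr_ge0 (s - 4); lra.
(* [n] doublings stretch the range of [cosh_le_small] to radius [2 ^ n / 2]. *)
have iterd (n : nat) : forall y : K, `|y| <= 2 ^+ n / 2 ->
    expR y + expR (- y) <= 2 * expR (y ^+ 2).
  elim: n => [|n IH] y hy; first by apply: cosh_le_small; rewrite expr0 in hy.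
  have -> : y = 2 * (y / 2) by lra.
  apply: dbl; apply: IH; rewrite normrM (@gtr0_norm _ 2^-1) ?invr_gt0 //.
  by rewrite ler_pdivrMr // divfK // (le_trans hy) // exprS; lra.
have [n xn] : exists n : nat, `|x| <= 2 ^+ n / 2.
  exists (Num.truncn (2 * `|x|)).+1.
  have h1 := truncnS_gt (2 * `|x|).
  have h2 : (Num.truncn (2 * `|x|)).+1%:R <= 2 ^+ (Num.truncn (2 * `|x|)).+1 :> K.
    by rewrite -natrX ler_nat ltnW // ltn_expl.
  lra.
exact: iterd xn.
Qed.

(* Hoeffding's lemma for two points: by Jensen, adding an independent copy with
   the opposite sign can only increase the left-hand side, and p (1 - p) <= 1/4
   bounds the symmetrised expectation by cosh (s / 2) ^ 2. *)
Lemma two_point_mgf (K : realType) (p s : K) : 0 <= p <= 1 ->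
  p * expR (- ((1 - p) * s)) + (1 - p) * expR (p * s) <= expR (s ^+ 2 / 2).
Proof.
move=> /andP[p0 p1].
have jensen : 1 <= p * expR ((1 - p) * s) + (1 - p) * expR (- (p * s)).
  have e1 := expR_ge1Dx ((1 - p) * s); have e2 := expR_ge1Dx (- (p * s)).
  have := ler_wpM2l p0 e1; have := @ler_wpM2l _ (1 - p) _ _ _ e2; nra.
set A := _ + _ in jensen *; set B := _ + _ in jensen *.
have B0 : 0 < B.
  rewrite /B; have := expR_gt0 (- ((1 - p) * s)); have := expR_gt0 (p * s); nra.
have AB : B * A = 1 + p * (1 - p) * (expR s + expR (- s) - 2).
  rewrite /A /B.
  set q := 1 - p.
  have e1 : expR (- (q * s)) * expR (q * s) = 1 by rewrite -expRD addNr expR0.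
  have e2 : expR (p * s) * expR (- (p * s)) = 1 by rewrite -expRD subrr expR0.
  have e3 : expR (- (q * s)) * expR (- (p * s)) = expR (- s).
    by rewrite -expRD; congr expR; rewrite /q; ring.
  have e4 : expR (p * s) * expR (q * s) = expR s.
    by rewrite -expRD; congr expR; rewrite /q; ring.
  transitivity (p ^+ 2 * (expR (- (q * s)) * expR (q * s))
    + q ^+ 2 * (expR (p * s) * expR (- (p * s)))
    + p * q * (expR (- (q * s)) * expR (- (p * s)))
    + p * q * (expR (p * s) * expR (q * s))); first by ring.
  by rewrite e1 e2 e3 e4 /q; ring.
have BA : B <= B * A by rewrite ler_peMr // ltW.
apply: (le_trans BA); rewrite AB.
have c2 := cosh_le (s / 2).
have sq (z : K) : expR z = expR (z / 2) ^+ 2.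
  by rewrite -expRM_natl; congr expR; lra.
have ab : expR (s / 2) * expR (- (s / 2)) = 1 by rewrite -expRD subrr expR0.
rewrite (sq s) (sq (- s)) (sq (s ^+ 2 / 2)) mulNr.
have E : s ^+ 2 / 2 / 2 = (s / 2) ^+ 2 by field.
rewrite E.
set a := expR (s / 2) in ab c2 *; set b := expR (- (s / 2)) in ab c2 *.
set c := expR _ in c2 *.
have a0 : 0 < a by exact: expR_gt0.
have b0 : 0 < b by exact: expR_gt0.
have c0 : 0 < c by exact: expR_gt0.
(* This is 4 sinh(s/2)^2, so the factor p(1 - p) <= 1/4 leaves 1 + sinh(s/2)^2 = cosh(s/2)^2. *)
have D : a ^+ 2 + b ^+ 2 - 2 = (a - b) ^+ 2 by rewrite sqrrB ab; ring.
have D2 : (a - b) ^+ 2 = (a + b) ^+ 2 - 4 by rewrite sqrrB sqrrD ab; ring.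
have k : (a + b) ^+ 2 <= (2 * c) ^+ 2 by apply: lerXn2r; rewrite ?nnegrE; nra.
have pq : p * (1 - p) <= 1 / 4 by have := sqr_ge0 (p - 1 / 2); lra.
have := ler_wpM2r (sqr_ge0 (a - b)) pq.
rewrite D; rewrite exprMn in k; lra.
Qed.

(** Stated with unnormalised weights, to be used with the sizes of two fibres. For p = l/(l + u) the
    offsets from the mean are -(1 - p)(y - x) and p(y - x). *)
Lemma two_point_mean_mgf (K : realType) (l u x y t d : K) :
  0 < l -> 0 < u -> `|y - x| <= d ->
  l * expR (t * (x - (l * x + u * y) / (l + u))) +
  u * expR (t * (y - (l * x + u * y) / (l + u)))
    <= (l + u) * expR ((t * d) ^+ 2 / 2).
Proof.
move=> l0 u0 xy.
have lu : 0 < l + u by lra.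
have lu0 : l + u != 0 by rewrite gt_eqF.
pose p := l / (l + u).
have p0 : 0 <= p by rewrite divr_ge0 // ltW.
have p1 : p <= 1 by rewrite ler_pdivrMr // mul1r; lra.
have pq : 1 - p = u / (l + u) by rewrite /p; field.
have -> : t * (x - (l * x + u * y) / (l + u)) = - ((1 - p) * (t * (y - x))).
  by rewrite pq; field.
have -> : t * (y - (l * x + u * y) / (l + u)) = p * (t * (y - x)).
  by rewrite /p; field.
have lE : l = (l + u) * p by rewrite /p; field.
have uE : u = (l + u) * (1 - p) by rewrite pq; field.
rewrite [X in X * _ + _]lE [X in _ + X * _]uE.
rewrite -(mulrA _ p) -(mulrA _ (1 - p)) -mulrDr ler_pM2l //.
apply: (le_trans (@two_point_mgf _ p _ _)); first by rewrite p0.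
rewrite ler_expR ler_pM2r ?invr_gt0 // -[(t * (y - x)) ^+ 2]real_normK ?num_real //.
rewrite -[(t * d) ^+ 2]real_normK ?num_real // !normrM.
have d0 : 0 <= d by apply: le_trans xy.
apply: lerXn2r; rewrite ?nnegrE ?mulr_ge0 // (ger0_norm d0).
exact: ler_wpM2l.
Qed.

(** Markov's inequality for both tails, in terms of counts: each counted [h] contributes at least
    exp(t r) to the two sums together. *)
Lemma chernoff (K : realType) (T : Type) (A : seq T) (X : T -> K) (t r q : K) :
  0 <= t ->
  \sum_(h <- A) expR (t * X h) <= (size A)%:R * q ->
  \sum_(h <- A) expR (- t * X h) <= (size A)%:R * q ->
  (count (fun h => r < `|X h|) A)%:R * expR (t * r) <= 2 * ((size A)%:R * q).
Proof.
move=> t0 hp hn; have -> (z : K) : 2 * z = z + z by lra.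
apply: le_trans (lerD hp hn); rewrite -big_split {hp hn} /=.
elim: A => [|h A IH]; first by rewrite big_nil mul0r.
rewrite big_cons /= natrD mulrDl; apply: lerD => //.
case: (ltP r) => [rX|_] /=; last by rewrite mul0r addr_ge0 ?expR_ge0.
rewrite mul1r; have [X0|X0] := leP 0 (X h).
- rewrite -[leLHS]addr0 lerD ?expR_ge0 // ler_expR ler_wpM2l //.
  by rewrite ger0_norm // in rX; exact: ltW.
- rewrite -[leLHS]add0r lerD ?expR_ge0 // ler_expR mulNr -mulrN ler_wpM2l //.
  by rewrite ltr0_norm // in rX; exact: ltW.
Qed.

(** * Conditional means of a height *)

Definition fshift (V : finType) (j : int) (h : {ffun V -> int}) :
  {ffun V -> int} := [ffun u => h u + j].

Lemma fshift_inj (V : finType) (j : int) : injective (@fshift V j).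
Proof.
by move=> h g /ffunP E; apply/ffunP => u; move: (E u); rewrite !ffunE => /addIr.
Qed.

(** For [j = 0] this makes [A] a sublattice. In general it is the closure condition comparing [A]
    with its translate by [j], the maximum being translated back into [A]. *)
Definition shift_closed (V : finType) (j : int) (A : seq {ffun V -> int}) :=
  forall h g, h \in A -> g \in A ->
    fmin g (fshift j h) \in A /\ fmax (fshift (- j) g) h \in A.

(** Fixing the height [a] at [x] is harmless because min(a, a + j) = a = max(a - j, a). *)
Lemma shift_closed_fiber (V : finType) (j : int) (A : seq {ffun V -> int})
    (x : V) (a : int) :
  0 <= j -> shift_closed j A -> shift_closed j [seq h : {ffun V -> int} <- A | h x == a].
Proof.
move=> j0 cA h g; rewrite !mem_filter => /andP[/eqP hx hA] /andP[/eqP gx gA].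
have [mA MA] := cA _ _ hA gA; rewrite mA MA !ffunE hx gx.
rewrite min_l ?lerDl // max_r ?eqxx // gerBl //.
Qed.

Definition mean (K : realType) (V : finType) (A : seq {ffun V -> int}) (v : V) : K :=
  (\sum_(h <- A) (h v)%:~R) / (size A)%:R.

Lemma mean_le (K : realType) (V : finType) (L U : seq {ffun V -> int}) (v : V) :
  uniq L -> uniq U -> L != [::] -> U != [::] ->
  (forall h g, h \in L -> g \in U -> fmin h g \in L /\ fmax h g \in U) ->
  mean K L v <= mean K U v.
Proof.
move=> uL uU L0 U0 LU.
pose M := \max_(h <- L ++ U) `|h v|%N.
have hM h : h \in L ++ U -> (`|h v| <= M)%N.
  move=> hLU.
  exact: (@leq_bigmax_seq _ _ predT (fun h : {ffun V -> int} => `|h v|%N) h hLU).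
clearbody M.
(* [holley] wants a natural-valued weight monotone on all functions: adding [M] makes the height
   nonnegative on [L] and [U], and truncating at 0 keeps monotonicity elsewhere. The added [M]
   cancels in the end. *)
pose w (h : {ffun V -> int}) := `|(Num.max (h v + M%:Z) 0)%R|%N.
have wE (h : {ffun V -> int}) : h \in L ++ U -> (w h)%:R = (h v)%:~R + M%:R :> K.
  move=> hLU; rewrite /w.
  have aux (p : int) : (`|p| <= M)%N ->
    `|(Num.max (p + M%:Z) 0)%R|%N%:Z = p + M%:Z by lia.
  by rewrite pmulrn aux ?hM // intrD.
have w_mono (h g : {ffun V -> int}) : (forall u, h u <= g u) -> (w h <= w g)%N.
  have aux (p q : int) : p <= q ->
    (`|(Num.max (p + M%:Z) 0)%R| <= `|(Num.max (q + M%:Z) 0)%R|)%N by lia.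
  by move=> hg; apply: aux.
have sumE (A : seq {ffun V -> int}) : {subset A <= L ++ U} ->
    (\sum_(h <- A) w h)%N%:R = \sum_(h <- A) (h v)%:~R + M%:R * (size A)%:R :> K.
  move=> sA; rewrite natr_sum; under eq_big_seq => h hA do rewrite wE ?sA //.
  by rewrite big_split /= big_const_seq count_predT iter_addr_0 mulr_natr.
have szL : 0 < (size L)%:R :> K by rewrite ltr0n lt0n size_eq0.
have szU : 0 < (size U)%:R :> K by rewrite ltr0n lt0n size_eq0.
have := holley uL uU LU w_mono.
rewrite -(ler_nat K) !natrM !sumE; last 2 first.
- by move=> h hU; rewrite mem_cat hU orbT.
- by move=> h hL; rewrite mem_cat hL.
rewrite /mean ler_pdivrMr // mulrAC ler_pdivlMr // !mulrDr.
by move=> H; lra.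
Qed.

Lemma mean_fshift (K : realType) (V : finType) (A : seq {ffun V -> int}) (v : V) j :
  A != [::] -> mean K (map (fshift j) A) v = mean K A v + j%:~R.
Proof.
move=> A0; have szA : (size A)%:R != 0 :> K by rewrite pnatr_eq0 size_eq0.
rewrite /mean big_map size_map; under eq_bigr => h _ do rewrite ffunE intrD.
rewrite big_split /= big_const_seq count_predT iter_addr_0 -(mulr_natr j%:~R).
by rewrite mulrDl mulfK.
Qed.

(* Comparing the upper fibre with the lower one translated by [j] gives the
   upper bound. *)
Lemma mean_fibers (K : realType) (V : finType) (A : seq {ffun V -> int})
    (x v : V) (a j : int) :
  let L := [seq h : {ffun V -> int} <- A | h x == a] in
  let U := [seq h : {ffun V -> int} <- A | h x == a + j] in
  0 <= j -> uniq A -> shift_closed 0 A -> shift_closed j A ->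
  L != [::] -> U != [::] -> `|mean K U v - mean K L v| <= j%:~R.
Proof.
move=> L U j0 uA cA0 cAj L0 U0.
have uL : uniq L by exact: filter_uniq.
have uU : uniq U by exact: filter_uniq.
have fs0 (h : {ffun V -> int}) : fshift 0 h = h.
  by apply/ffunP => u; rewrite ffunE addr0.
have LeU : mean K L v <= mean K U v.
  apply: mean_le => // h g; rewrite !mem_filter.
  move=> /andP[/eqP hx hA] /andP[/eqP gx gA].
  have [mA _] := cA0 _ _ gA hA; have [_ MA] := cA0 _ _ gA hA.
  move: mA MA; rewrite oppr0 !fs0 => -> ->; rewrite !ffunE hx gx.
  by rewrite min_l ?max_r ?lerDl ?eqxx.
have UeL : mean K U v <= mean K (map (fshift j) L) v.
  apply: mean_le => //.
  - by rewrite map_inj_uniq //; exact: fshift_inj.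
  - by case: (L) L0.
  move=> g h' gU /mapP[h hL ->].
  move: gU hL; rewrite !mem_filter => /andP[/eqP gx gA] /andP[/eqP hx hA].
  have [mA MA] := cAj _ _ hA gA; split.
    by rewrite mA !ffunE hx gx minxx eqxx.
  have -> : fmax g (fshift j h) = fshift j (fmax (fshift (- j) g) h).
    by apply/ffunP => u; rewrite !ffunE addr_maxl subrK.
  rewrite (mem_map (@fshift_inj _ j)) mem_filter MA !ffunE hx gx.
  by rewrite addrK maxxx eqxx.
rewrite mean_fshift // in UeL.
by rewrite ger0_norm ?subr_ge0 // lerBlDr addrC.
Qed.

Lemma mean_cat (K : realType) (V : finType) (A L U : seq {ffun V -> int}) v :
  perm_eq A (L ++ U) -> L != [::] -> U != [::] ->
  mean K A v = ((size L)%:R * mean K L v + (size U)%:R * mean K U v) /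
               ((size L)%:R + (size U)%:R).
Proof.
move=> pA L0 U0; rewrite /mean (perm_big _ pA) big_cat /= (perm_size pA) size_cat.
have szL : (size L)%:R != 0 :> K by rewrite pnatr_eq0 size_eq0.
have szU : (size U)%:R != 0 :> K by rewrite pnatr_eq0 size_eq0.
by rewrite natrD ![_%:R * (_ / _)]mulrC !divfK.
Qed.

(* Induction along the path: conditioning on the next height splits [A] into at
   most two fibres, whose means differ by at most [j]. *)
Lemma mgf_path (K : realType) (V : finType) (e : rel V) (j : int) (t : K) xs :
  0 <= j ->
  forall (A : seq {ffun V -> int}) (x : V) (a : int),
  uniq A -> shift_closed 0 A -> shift_closed j A ->
  (forall y z b, e y z -> exists c, forall h, h \in A -> h y = b ->
     h z = c \/ h z = c + j) ->
  (forall h, h \in A -> h x = a) -> path e x xs ->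
  \sum_(h <- A) expR (t * ((h (last x xs))%:~R - mean K A (last x xs)))
    <= (size A)%:R * expR ((t * j%:~R) ^+ 2 / 2 * (size xs)%:R).
Proof.
move=> j0; elim: xs => [|y xs IH] A x a uA cA0 cAj step hx /=.
  move=> _; rewrite mulr0 expR0 mulr1.
  have [->|A0] := eqVneq A [::]; first by rewrite big_nil.
  have szA : (size A)%:R != 0 :> K by rewrite pnatr_eq0 size_eq0.
  have mA : mean K A x = a%:~R.
    rewrite /mean (eq_big_seq (fun=> a%:~R)); last by move=> h hA; rewrite hx.
    by rewrite big_const_seq count_predT iter_addr_0 -(mulr_natr a%:~R) mulfK.
  rewrite (eq_big_seq (fun=> 1)); last first.
    by move=> h hA; rewrite hx // mA subrr mulr0 expR0.
  by rewrite big_const_seq count_predT iter_addr_0.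
case/andP => exy pxs; have [c hc] := step _ _ a exy.
set v := last y xs.
set L := [seq h : {ffun V -> int} <- A | h y == c].
set U := [seq h : {ffun V -> int} <- A | h y == c + j].
have IHf b : let B := [seq h : {ffun V -> int} <- A | h y == b] in
    \sum_(h <- B) expR (t * ((h v)%:~R - mean K B v))
      <= (size B)%:R * expR ((t * j%:~R) ^+ 2 / 2 * (size xs)%:R).
  apply: (IH _ y b) => //.
  - exact: filter_uniq.
  - exact: shift_closed_fiber.
  - exact: shift_closed_fiber.
  - move=> p q r epq; have [d hd] := step p q r epq; exists d => h.
    by rewrite mem_filter => /andP[_]; exact: hd.
  - by move=> h; rewrite mem_filter => /andP[/eqP].
set q := (t * j%:~R) ^+ 2 / 2.
have q0 : 0 <= q by rewrite divr_ge0 ?sqr_ge0.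
have expS : expR (q * (size xs).+1%:R) = expR q * expR (q * (size xs)%:R).
  by rewrite -expRD -natr1; congr expR; ring.
(* If the height at [y] is already determined, revealing it costs nothing and the bound for [xs] has
   room to spare. *)
have one b : all (fun h : {ffun V -> int} => h y == b) A ->
    \sum_(h <- A) expR (t * ((h v)%:~R - mean K A v))
      <= (size A)%:R * expR (q * (size xs).+1%:R).
  move=> /all_filterP AE; have := IHf b; rewrite /= AE => H.
  apply: (le_trans H); rewrite ler_wpM2l // ler_expR ler_wpM2l // ler_nat.
  exact: leqnSn.
have yE h : h \in A -> (h y == c) || (h y == c + j).
  by move=> hA; case: (hc h hA (hx _ hA)) => ->; rewrite eqxx ?orbT.
(* For [j = 0] the two fibres coincide and do not partition [A]. *)
have [j_eq0|jn0] := eqVneq j 0.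
  by apply: (one c); apply/allP => h /yE; rewrite j_eq0 addr0 orbb.
have [L0|L0] := eqVneq L [::].
  apply: (one (c + j)); apply/allP => h hA; case/orP: (yE h hA) => // hy.
  by have := mem_filter (fun h : {ffun V -> int} => h y == c) h A; rewrite -/L L0 hy hA.
have [U0|U0] := eqVneq U [::].
  apply: (one c); apply/allP => h hA; case/orP: (yE h hA) => // hy.
  by have := mem_filter (fun h : {ffun V -> int} => h y == c + j) h A; rewrite -/U U0 hy hA.
have pA : perm_eq A (L ++ U).
  have -> : U = [seq h : {ffun V -> int} <- A | ~~ (h y == c)].
    apply: eq_in_filter => h /yE; case: eqP => [->|_] //= _.
    by apply/negbTE; rewrite -subr_eq0 opprD addrA subrr add0r oppr_eq0.
  by rewrite perm_sym; exact: permEl (perm_filterC _ _).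
have szL : 0 < (size L)%:R :> K by rewrite ltr0n lt0n size_eq0.
have szU : 0 < (size U)%:R :> K by rewrite ltr0n lt0n size_eq0.
(* Recentring at the fibre's own mean: the inner sum falls to the induction hypothesis, and the
   outer factors form a two-point moment generating function. *)
have split (B : seq {ffun V -> int}) :
    \sum_(h <- B) expR (t * ((h v)%:~R - mean K A v)) =
    expR (t * (mean K B v - mean K A v)) *
      \sum_(h <- B) expR (t * ((h v)%:~R - mean K B v)).
  by rewrite mulr_sumr; apply: eq_bigr => h _; rewrite -expRD; congr expR; ring.
rewrite [leLHS](perm_big _ pA) big_cat /= !split.
have mLU : `|mean K U v - mean K L v| <= j%:~R by exact: mean_fibers.
have := two_point_mean_mgf t szL szU mLU; rewrite -(mean_cat _ _ pA) // -/q => two.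
rewrite expS (perm_size pA) size_cat natrD mulrA.
apply: le_trans (ler_wpM2r (expR_ge0 _) two); rewrite mulrDl.
by apply: lerD; rewrite [X in _ <= X * _]mulrC -mulrA;
  (apply: ler_wpM2l; [exact: expR_ge0|exact: IHf]).
Qed.

(** * Completions of a boundary height function *)

Lemma vertex_adj_sym (R : {fset lattice}) : symmetric (@vertex_adj R).
Proof.
have half (u w : vertices R) : vertex_adj u w -> vertex_adj w u.
  rewrite /vertex_adj => /andP[n /existsP[s /andP[s1 s2]]].
  apply/andP; split; last by apply/existsP; exists s; rewrite s1 s2.
  by move: n; rewrite /neighbours; lia.
by move=> u w; apply/idP/idP; exact: half.
Qed.

(** The squares on the two sides of an edge are neighbours, so one is black and the height rule
    applies in one of the two directions. *)
Lemma black_left_square (black : pred lattice) (R : {fset lattice})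
    (u w : vertices R) : checkerboard black -> vertex_adj u w ->
  black (left_square (val u) (val w)) \/ black (left_square (val w) (val u)).
Proof.
move=> chk /andP[n _]; apply/orP; case: (val u) (val w) n => [x y] [a b] n.
suff /chk -> : neighbours (left_square (x, y) (a, b)) (left_square (a, b) (x, y)).
  by case: (black _).
move: n; rewrite /neighbours /left_square /= !xpair_eqE /=.
by do ![case: ifP => /=]; lia.
Qed.

Lemma vertex_carrier (K : realType) (R : {fset lattice}) (u : vertices R) :
  carrier K R (pt K (val u)).
Proof.
have : val u \in vertices R by exact: fsvalP.
case: (val u) => x y /verticesP[[a b] sR cs].
exists (a, b) => //; rewrite /pt /=; move: cs.
by rewrite !inE !xpair_eqE /= => /or4P[] /andP[/eqP -> /eqP ->];
  rewrite ?intrD /=; split; lra.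
Qed.

Lemma interior_or_boundary (K : realType) (R : {fset lattice}) (u : vertices R) :
  interior_vertex K u \/ boundary_vertex K u.
Proof.
have [|nu] := pselect (interior_vertex K u); [by left|right].
by split => //; apply: subset_closure; exact: vertex_carrier.
Qed.

(** Walking left from any vertex reaches the boundary, since fewer vertices remain further left
    after each step. Properties that spread along edges thus pass from the boundary to all
    vertices. *)
Lemma left_boundary_ind (K : realType) (R : {fset lattice})
    (P : vertices R -> Prop) :
  (forall u, boundary_vertex K u -> P u) ->
  (forall u w, vertex_adj u w -> P w -> P u) -> forall u, P u.
Proof.
move=> Pb Pl u.
move En : #|[set w : vertices R | ((val w).1 < (val u).1)%R]%SET| => n.
elim/ltn_ind: n u En => n IH u En.
have [iu|] := interior_or_boundary K u; last exact: Pb.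
have [w uw wE] := interior_left iu.
apply: (Pl _ _ uw); apply: (IH _ _ w erefl); rewrite -En.
apply: proper_card; apply/properP; split.
  by apply/fintype.subsetP => z; rewrite !inE wE /=; lia.
by exists w; rewrite !inE wE /=; lia.
Qed.

(** Both functions agree on the boundary, and the two permitted increments 1 and -3 are congruent
    modulo 4. *)
Lemma completions_mod4 (K : realType) (black : pred lattice)
    (R : {fset lattice}) (f : vertices R -> option int)
    (h g : {ffun vertices R -> int}) :
  checkerboard black -> (forall u, boundary_vertex K u -> isSome (f u)) ->
  completions K black f h -> completions K black f g ->
  forall u, exists k : int, h u = g u + 4 * k.
Proof.
move=> chk fb [hh hf] [hg gf]; apply: (@left_boundary_ind K).
  move=> u /fb; case fu : (f u) => [a|//] _; exists 0.
  by rewrite (hf _ _ fu) (gf _ _ fu); lia.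
move=> u w uw [k hk].
have wu : vertex_adj w u by rewrite vertex_adj_sym.
have aux (hu hw gu gw : int) : hw = gw + 4 * k ->
    (hw = hu + 1 \/ hw = hu - 3) /\ (gw = gu + 1 \/ gw = gu - 3) \/
    (hu = hw + 1 \/ hu = hw - 3) /\ (gu = gw + 1 \/ gu = gw - 3) ->
    exists k', hu = gu + 4 * k'.
  move=> E H; suff [|[|]] : hu = gu + 4 * k \/ hu = gu + 4 * (k + 1) \/
    hu = gu + 4 * (k - 1) by [exists k|exists (k + 1)|exists (k - 1)].
  lia.
apply: aux hk _; have [b|b] := black_left_square chk uw; [left|right].
- by split; [exact: (hh _ _ uw).2|exact: (hg _ _ uw).2].
- by split; [exact: (hh _ _ wu).2|exact: (hg _ _ wu).2].
Qed.

(* Heights that agree modulo 4 cannot cross along an edge, so on every edge the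
   minimum and the maximum coincide with one of the two functions. *)
Lemma height_function_minmax (K : realType) (black : pred lattice)
    (R : {fset lattice}) (h g : {ffun vertices R -> int}) :
  checkerboard black ->
  (forall u, exists k : int, h u = g u + 4 * k) ->
  height_function K black h -> height_function K black g ->
  height_function K black (fmin h g) /\ height_function K black (fmax h g).
Proof.
move=> chk mod4 hh hg.
(* The difference is a multiple of 4 and changes by at most 4 along an edge, whereas a strict
   crossing would need a change of at least 8. *)
have no_cross u w : vertex_adj u w ->
    h u <= g u /\ h w <= g w \/ g u <= h u /\ g w <= h w.
  move=> uw; have wu : vertex_adj w u by rewrite vertex_adj_sym.
  have aux (hu hw gu gw : int) : (exists k : int, hu = gu + 4 * k) ->
    (exists k : int, hw = gw + 4 * k) ->
    (hw = hu + 1 \/ hw = hu - 3) /\ (gw = gu + 1 \/ gw = gu - 3) \/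
    (hu = hw + 1 \/ hu = hw - 3) /\ (gu = gw + 1 \/ gu = gw - 3) ->
    hu <= gu /\ hw <= gw \/ gu <= hu /\ gw <= hw.
    by move=> [k hk] [l hl]; lia.
  apply: aux; [exact: mod4|exact: mod4|].
  have [b|b] := black_left_square chk uw; [left|right].
  - by split; [exact: (hh _ _ uw).2|exact: (hg _ _ uw).2].
  - by split; [exact: (hh _ _ wu).2|exact: (hg _ _ wu).2].
split=> u w uw; rewrite !ffunE.
- case: (no_cross u w uw) => -[le1 le2].
  + by rewrite !min_l //; exact: hh.
  + by rewrite !min_r //; exact: hg.
- case: (no_cross u w uw) => -[le1 le2].
  + by rewrite !max_r //; exact: hg.
  + by rewrite !max_l //; exact: hh.
Qed.

Lemma height_function_fshift (K : realType) (black : pred lattice)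
    (R : {fset lattice}) (j : int) (h : {ffun vertices R -> int}) :
  height_function K black h -> height_function K black (fshift j h).
Proof.
move=> hh u w /hh; rewrite !ffunE => -[h1 h2]; split.
  by move=> /h1 <-; rewrite opprD addrACA subrr addr0.
by move=> /h2[] ->; [left|right]; rewrite addrAC.
Qed.

(** A shift by a multiple of 4 preserves the congruences, so [height_function_minmax] applies. Where
    [f] is defined, [0 <= i] makes the minimum and the maximum select the unshifted function. *)
Lemma completions_shift (K : realType) (black : pred lattice)
    (R : {fset lattice}) (f : vertices R -> option int) (i : int)
    (h g : {ffun vertices R -> int}) :
  checkerboard black -> (forall u, boundary_vertex K u -> isSome (f u)) ->
  0 <= i -> completions K black f h -> completions K black f g ->
  completions K black f (fmin g (fshift (4 * i) h)) /\
  completions K black f (fmax (fshift (- (4 * i)) g) h).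
Proof.
move=> chk fb i0 ch cg; have mod4 := completions_mod4 chk fb cg ch.
case: ch cg => [hh hf] [hg gf]; split; split.
- apply: (height_function_minmax chk _ hg (height_function_fshift _ hh)).1 => u.
  by have [k ->] := mod4 u; exists (k - i); rewrite ffunE; ring.
- move=> u a fu; rewrite !ffunE (hf _ _ fu) (gf _ _ fu).
  by rewrite min_l // lerDl mulr_ge0.
- apply: (height_function_minmax chk _ (height_function_fshift _ hg) hh).2 => u.
  by have [k E] := mod4 u; exists (k - i); rewrite ffunE E; ring.
- move=> u a fu; rewrite !ffunE (hf _ _ fu) (gf _ _ fu).
  by rewrite max_r // gerBl mulr_ge0.
Qed.

(** * The concentration bound *)

Theorem theorem21 (K : realType) (black : pred lattice) (R : {fset lattice})
    (f : vertices R -> option int) (v : vertices R)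
    (m : nat) (x0 : vertices R) (xs : seq (vertices R)) (c : K) :
  checkerboard black ->
  tileable R ->
  simply_connected K (carrier K R) ->
  partial_height_function K black f ->
  (forall u, isSome (f u) <-> boundary_vertex K u) ->
  completions K black f !=set0 ->
  interior_vertex K v ->
  boundary_vertex K x0 ->
  path (@vertex_adj R) x0 xs ->
  last x0 xs = v ->
  size (x0 :: xs) = m ->
  0 < c ->
  mu K black f
      (fun H => c * Num.sqrt m%:R <
        `|(H v)%:~R - mu_expectation black f (fun H' => (H' v)%:~R)|)
    < 2 * expR (- (c ^+ 2 / 32)).
Proof.
move=> chk _ _ _ fbd [h0 ch0] _ bx0 pxs lxs sxs c0.
have fb u : boundary_vertex K u -> isSome (f u) by move/fbd.
pose A : seq {ffun vertices R -> int} := fset_set (completions K black f).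
have memA h : (h \in A) = (h \in completions K black f).
  by rewrite /A in_fset_set //; exact: finite_completions.
have uA : uniq A by exact: fset_uniq.
have AC h : h \in A -> completions K black f h by rewrite memA inE.
have closed (i : int) : 0 <= i -> shift_closed (4 * i) A.
  move=> i0 h g /AC ch /AC cg; rewrite !memA !inE.
  exact: completions_shift.
have cA0 : shift_closed 0 A by exact: (closed 0).
have cA4 : shift_closed 4 A by exact: (closed 1).
have [a fx0] : exists a, f x0 = Some a.
  by have := fb _ bx0; case: (f x0) => // a _; exists a.
have hx0 h : h \in A -> h x0 = a by move=> /AC[_]; exact.
have step y z b : vertex_adj y z -> exists d, forall h, h \in A -> h y = b ->
    h z = d \/ h z = d + 4.
  move=> yz; have zy : vertex_adj z y by rewrite vertex_adj_sym.
  have [bl|bl] := black_left_square chk yz.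
  (* Black on the left from [y] to [z] gives b - 3 or b + 1; the opposite orientation gives b - 1 or
     b + 3. *)
  - exists (b - 3) => h /AC[hh _] hy; have := (hh _ _ yz).2 bl; rewrite hy.
    by move=> [->|->]; [right; ring|left].
  - exists (b - 1) => h /AC[hh _] hy; have := (hh _ _ zy).2 bl; rewrite hy.
    by move=> [E|E]; [left|right]; rewrite E; ring.
have mgf (t : K) := mgf_path t (isT : 0 <= 4 :> int) uA cA0 cA4 step hx0 pxs.
rewrite lxs in mgf.
have szA : 0 < (size A)%:R :> K.
  rewrite ltr0n; have : h0 \in A by rewrite memA inE.
  by case: (A).
have -> : mu_expectation black f (fun H' => (H' v)%:~R) = mean K A v by [].
have muE E : mu K black f E = (count E A)%:R / (size A)%:R.
  rewrite -size_filter; congr (_%:R / _); apply: perm_size.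
  apply: uniq_perm; [exact: fset_uniq|exact: filter_uniq|move=> h].
  by rewrite mem_filter !inE andbC.
rewrite muE ltr_pdivrMr //.
set s := Num.sqrt _.
have s0 : 0 < s by rewrite sqrtr_gt0 ltr0n -sxs.
have s2 : s ^+ 2 = (size xs)%:R + 1 by rewrite sqr_sqrtr // -sxs /= natr1.
(* This minimises 8 t^2 m - t c s, where s^2 = m; the minimum is c^2/32 - c^2/16 = -c^2/32. *)
pose t := c / (16 * s).
have t0 : 0 <= t by rewrite divr_ge0 // ?mulr_ge0 // ltW.
have mgfN := mgf (- t); rewrite mulNr (sqrrN (t * _)) in mgfN.
have := chernoff (c * s) t0 (mgf t) mgfN.
have -> : t * (c * s) = c ^+ 2 / 16 by rewrite /t; field; rewrite gt_eqF.
(* The height at [x0] is known, so only m - 1 heights are revealed; (m - 1)/m < 1 makes the final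
   inequality strict. *)
have lt_exp : (t * 4%:~R) ^+ 2 / 2 * (size xs)%:R < c ^+ 2 / 32.
  have -> : (t * 4%:~R) ^+ 2 / 2 * (size xs)%:R =
      c ^+ 2 / 32 * ((size xs)%:R / s ^+ 2) by rewrite /t; field; rewrite gt_eqF.
  rewrite -[ltRHS]mulr1 ltr_pM2l ?divr_gt0 ?exprn_gt0 //.
  by rewrite s2 ltr_pdivrMr ?mul1r ?ltrDl // ltr_wpDl.
rewrite -(ltr_expR) in lt_exp.
have -> : - (c ^+ 2 / 32) = c ^+ 2 / 32 - c ^+ 2 / 16 by lra.
rewrite expRD expRN -ler_pdivlMr ?expR_gt0 // => /le_lt_trans; apply.
rewrite [ltRHS](_ : _ = 2 * ((size A)%:R * expR (c ^+ 2 / 32)) / expR (c ^+ 2 / 16)).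
  by rewrite ltr_pM2r ?invr_gt0 ?expR_gt0 // !ltr_pM2l.
by field; rewrite gt_eqF ?expR_gt0.
Qed.
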